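(* Let $\mathbf{G}=\mathbf{G}(a,b)$ with $(a,b)\in\mathbb{C}^2\setminus\{(0,0)\}$. If either $a=0$ or $b=0$, then $\Psi(X,T;\mathbf{G})=0$ for all $(X,T)\in\mathbb{R}^2$.
   Context: Notation: $*$ is complex conjugation; $\sigma_3=\mathrm{diag}(1,-1)$; $\mathrm{e}^{f\sigma_3}=\mathrm{diag}(\mathrm{e}^{f},\mathrm{e}^{-f})$. For $(a,b)\in\mathbb{C}^2\setminus\{(0,0)\}$ let $$\mathbf{G}(a,b)=\frac{1}{\sqrt{|a|^2+|b|^2}}\begin{bmatrix}a & b^*\\ -b & a^*\end{bmatrix}.$$ For $(X,T)\in\mathbb{R}^2$ and $\mathbf{G}=\mathbf{G}(a,b)$, $\mathbf{P}(\Lambda;X,T,\mathbf{G})$ denotes the unique (it is known to exist) $2\times 2$ matrix function of $\Lambda$ such that: (i) it is analytic for $|\Lambda|\neq 1$ and takes continuous boundary values on the unit circle from the interior and from the exterior; (ii) writing $\mathbf{P}_+$ (resp. $\mathbf{P}_-$) for the boundary value on $|\Lambda|=1$ from the exterior (resp. interior), $$\mathbf{P}_+=\mathbf{P}_-\,\mathrm{e}^{-\mathrm{i}(\Lambda X+\Lambda^2T+2\Lambda^{-1})\sigma_3}\,\mathbf{G}\,\mathrm{e}^{\mathrm{i}(\Lambda X+\Lambda^2T+2\Lambda^{-1})\sigma_3},\quad |\Lambda|=1;$$ (iii) $\mathbf{P}\to\mathbb{I}$ as $\Lambda\to\infty$. Then $\Psi(X,T;\mathbf{G}):=2\mathrm{i}\lim_{\Lambda\to\infty}\Lambda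 P_{12}(\Lambda;X,T,\mathbf{G})$. *)

(* Defs.v *)
From mathcomp Require Import all_boot all_order all_algebra complex.
From mathcomp Require Import all_classical all_reals all_analysis.

Set Implicit Arguments.
Unset Strict Implicit.
Unset Printing Implicit Defensive.

Import Order.TTheory GRing.Theory Num.Theory.
Import numFieldNormedType.Exports.

Local Open Scope classical_set_scope.
Local Open Scope ring_scope.

(* R[i] carries no topology of its own; packaged as a numClosedFieldType it
   inherits the normed topology that numFieldNormedType gives to any such
   type, so [derivable _ _ 1] below is complex differentiability. *)
Definition Cplx (R : realType) : numClosedFieldType := R[i]%C.

Definition ofreal (R : realType) (x : R) : Cplx R := (x%:C)%C.

Definition cexp (R : realType) (z : Cplx R) : Cplx R :=
  ofreal (expR (complex.Re z))
  * (ofreal (cos (complex.Im z)) + 'i * ofreal (sin (complex.Im z))).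

(* The filter of neighbourhoods of the point at infinity of C. *)
Definition Cinfty (R : realType) : set_system (Cplx R) :=
  filter_from [set: R] (fun M => [set z : Cplx R | ofreal M < `|z|]).

Arguments Cinfty R : clear implicits.

#[global] Instance Cinfty_proper (R : realType) : ProperFilter (Cinfty R).
Proof.
apply: filter_from_proper; last first.
  move=> M _; exists (ofreal (`|M| + 1)) => /=.
  by rewrite normc_def /= expr0n addr0 sqrtr_sqr ltcR
     (ger0_norm (_ : 0 <= `|M| + 1)) ?addr_ge0//
     (le_lt_trans (ler_norm _))// ltrDl.
apply: filter_from_filter; first by exists 0.
move=> M N _ _; exists (Num.max M N) => // z /= Hz; split => /=.
  by apply: le_lt_trans Hz; rewrite lecR le_max lexx.
by apply: le_lt_trans Hz; rewrite lecR le_max lexx orbT.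
Qed.

Definition mx2 (A : Type) (a b c d : A) : 'M[A]_2 :=
  \matrix_(i, j) if i == 0 then (if j == 0 then a else b)
                 else (if j == 0 then c else d).

Definition exp_sigma3 (R : realType) (f : Cplx R) : 'M[Cplx R]_2 :=
  mx2 (cexp f) 0 0 (cexp (- f)).

Definition Gmx (R : realType) (a b : Cplx R) : 'M[Cplx R]_2 :=
  (sqrtC (`|a| ^+ 2 + `|b| ^+ 2))^-1 *: mx2 a b^* (- b) a^*.

Definition phase (R : realType) (X T : R) (L : Cplx R) : Cplx R :=
  L * ofreal X + L ^+ 2 * ofreal T + 2%:R * L^-1.

Definition jump_matrix (R : realType) (X T : R) (G : 'M[Cplx R]_2)
    (L : Cplx R) : 'M[Cplx R]_2 :=
  exp_sigma3 (- ('i * phase X T L)) *m G *m exp_sigma3 ('i * phase X T L).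

(* The value of P on the unit circle itself is irrelevant: only the boundary
   values Pext and Pint matter there. *)
Definition RHP_solution (R : realType) (X T : R) (G : 'M[Cplx R]_2)
    (P : Cplx R -> 'M[Cplx R]_2) : Prop :=
  (forall L, `|L| != 1 ->
    forall i j, derivable (fun z => P z i j) L 1) /\
  (exists Pext Pint : Cplx R -> 'M[Cplx R]_2,
    [/\ {within [set z : Cplx R | `|z| = 1], continuous Pext},
        {within [set z : Cplx R | `|z| = 1], continuous Pint},
        forall z, `|z| = 1 ->
          P L @[L --> within [set L | 1 < `|L|] (nbhs z)] --> Pext z,
        forall z, `|z| = 1 ->
          P L @[L --> within [set L | `|L| < 1] (nbhs z)] --> Pint z
      & forall z, `|z| = 1 -> Pext z = Pint z *m jump_matrix X T G z]) /\
  P L @[L --> Cinfty R] --> (1%:M : 'M[Cplx R]_2).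

Definition unique_RHP_solution (R : realType) (X T : R) (G : 'M[Cplx R]_2)
    (P : Cplx R -> 'M[Cplx R]_2) : Prop :=
  RHP_solution X T G P /\
  forall Q, RHP_solution X T G Q -> forall L, `|L| != 1 -> Q L = P L.

(* [is_Psi X T G psi] reads Psi(X,T;G) = psi.  Stated as a relation because
   both a choice of P and [lim] would silently take default values if P or the
   limit did not exist. *)
Definition is_Psi (R : realType) (X T : R) (G : 'M[Cplx R]_2)
    (psi : Cplx R) : Prop :=
  exists2 P, unique_RHP_solution X T G P &
    2%:R * 'i * (L * P L 0 1) @[L --> Cinfty R] --> psi.

(* Main.v *)
Require Import Defs.
From mathcomp Require Import all_boot all_order all_algebra complex.
From mathcomp Require Import all_classical all_reals all_analysis.
From mathcomp Require Import ring lra.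

Set Implicit Arguments.
Unset Strict Implicit.
Unset Printing Implicit Defensive.

Import Order.TTheory GRing.Theory Num.Theory.
Import numFieldNormedType.Exports.

Local Open Scope classical_set_scope.
Local Open Scope ring_scope.

(* If b = 0 the jump is the constant G, and P = 1 outside, G^-1 inside.  If
   a = 0 the jump is antidiagonal, and with th = z X + z^2 T it factors as
   N'(z) E(z), where E = diag(e^{4i/z}, e^{-4i/z}) is analytic off 0 and tends
   to 1 at infinity, and N' = offdiag(u e^{-2i th}, v e^{2i th}) is entire; so
   P = E outside and N'^-1 inside.  In both cases P_12 = 0 outside the circle.

   For uniqueness, if Q is another solution then Q E^-1 (outside) and Q N'
   (inside) glue to a function F continuous on C, differentiable off the
   circle and tending to 1 at infinity, and F must be constant: for a function
   continuous on C and differentiable off finitely many circles centred at 0,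
   the mean over the circle of radius e^s is locally constant in s (Goursat's
   bisection argument for F(e^{s+it})) and continuous in s, so its limits at
   s = -oo and s = +oo agree, i.e. F(0) = F(oo).  Applying this to
   z (F(z) - F(w)) / (z - w) gives F(w) = F(oo). *)

(** * Goursat's lemma for closed forms on rectangles *)

Section antiderivatives.
Context {R : realType}.
Implicit Types (h H : R -> R).

Lemma is_derive_eq_bound H h (a b e : R) : a <= b ->
  (forall x : R, is_derive x 1 H (h x)) ->
  (forall x : R, a <= x <= b -> `|h x| <= e) -> `|H b - H a| <= e * (b - a).
Proof.
move=> ab dH he.
have [|c cab ->] := @MVT_segment R H h a b ab (fun x _ => dH x).
  apply: continuous_subspaceT => x.
  exact/differentiable_continuous/derivable1_diffP/ex_derive.
have ba0 : 0 <= b - a by rewrite subr_ge0.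
rewrite normrM (ger0_norm ba0) ler_wpM2r//; apply: he.
by rewrite !(itvP cab).
Qed.

(** Subtracting the explicit antiderivative of the affine function from [H] reduces this to the mean
    value bound. It estimates an edge integral through a first-order expansion of the integrand. *)
Lemma antiderivative_affine_bound H h (a b c0 c1 e : R) : a <= b ->
  (forall x : R, is_derive x 1 H (h x)) ->
  (forall x : R, a <= x <= b -> `|h x - (c0 + c1 * x)| <= e) ->
  `|H b - H a - (c0 * (b - a) + c1 * (b ^+ 2 - a ^+ 2) / 2)| <= e * (b - a).
Proof.
move=> ab dH he.
pose K x := H x - (c0 * x + c1 / 2 * x ^+ 2).
have := @is_derive_eq_bound K (fun x => h x - (c0 + c1 * x)) a b e ab.
set l := `|_| <= _ => hl; suff : l.
  by rewrite /l; apply: le_trans; rewrite le_eqVlt /K;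
     apply/orP; left; apply/eqP; congr `|_|; field.
apply: hl => // x; rewrite /K.
have dHx := dH x.
apply: is_derive_eq.
by rewrite /GRing.scale /=; field.
Qed.

(** The integral from [a] works, but only to the right of its base point. *)
Lemma antiderivative_right h (a : R) : continuous h ->
  exists H, forall x : R, a < x -> is_derive x 1 H (h x).
Proof.
move=> ch; exists (fun x => \int[lebesgue_measure]_(t in `[a, x]) h t)%R => x ax.
have x1 : x < x + 1 by rewrite ltrDl.
have hi : lebesgue_measure.-integrable `[a, x + 1] (EFin \o h).
  by apply: continuous_compact_integrable; [exact: segment_compact|
    exact: continuous_subspaceT].
have [d e] := continuous_FTC1_closed x1 hi ax (ch x).
by apply: DeriveDef; [exact: d|rewrite -derive1E; exact: e].
Qed.

(** Reflection [x -> - x] of the previous lemma. *)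
Lemma antiderivative_left h (a : R) : continuous h ->
  exists H, forall x : R, x < a -> is_derive x 1 H (h x).
Proof.
move=> ch.
have [] := @antiderivative_right (fun x => - h (- x)) (- a).
  by move=> x; apply: continuousN; apply: continuous_comp; [exact: oppr_continuous|exact: ch].
move=> H HP; exists (fun x => H (- x)) => x xa.
have dH : is_derive (- x) 1 H (- h (- - x)) by apply: HP; rewrite ltrN2.
have /= := @is_derive1_comp R H (-%R) x _ _ dH (@is_deriveNid _ _ x 1).
by move/is_derive_eq; apply; rewrite opprK mulrN1 opprK.
Qed.

Lemma antiderivative_exists h : continuous h ->
  exists H, forall x : R, is_derive x 1 H (h x).
Proof.
move=> ch.
have [K KP] := @antiderivative_right h (-1) ch.
have [L LP] := @antiderivative_left h 1 ch.
exists (fun x => if 0 < x then K x - K 0 else L x - L 0) => x.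
(* The two halves overlap on []-1, 1[], where [K - L] has zero derivative; normalised at 0 they
   agree there, so the glued function is differentiable at the seam 0 too. *)
have KL (y : R) : -1 < y < 1 -> K y - K 0 = L y - L 0.
  move=> /andP[y1 y2].
  pose D (z : R) := K z - L z.
  have dD (z : R) : -1 < z < 1 -> is_derive z 1 D 0.
    move=> /andP[z1 z2]; have := KP _ z1; have := LP _ z2 => ? ?.
    by apply: is_derive_eq; rewrite subrr.
  have cD (z : R) : -1 < z < 1 -> {for z, continuous D}.
    by move=> /dD ?; apply/differentiable_continuous/derivable1_diffP/ex_derive.
  suff : D y = D 0 by rewrite /D; lra.
  have main (u v : R) : u <= v -> -1 < u -> v < 1 -> D u = D v.
    move=> uv u1 v1; have [||c _] := @MVT_segment R D (fun=> 0) u v uv.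
    - by move=> z; rewrite in_itv /= => /andP[? ?]; apply: dD; apply/andP; split; lra.
    - apply: continuous_in_subspaceT => z; rewrite inE /= in_itv /= => /andP[? ?].
      by apply: cD; apply/andP; split; lra.
    - by rewrite mul0r; lra.
  by have [y0|/ltW y0] := leP y 0; [apply: main => //; lra|symmetry; apply: main => //; lra].
have [x0|x0] := ltP 0 x.
  apply: (@near_eq_is_derive _ _ _ (fun x => K x - K 0)).
  - near=> y; rewrite ifT//; near: y; exact: lt_nbhsr.
  - have ? := KP x (lt_trans (ltrN10 _) x0).
    by apply: is_derive_eq; rewrite subr0.
apply: (@near_eq_is_derive _ _ _ (fun x => L x - L 0)).
- near=> y; case: ifPn => // y0; rewrite KL//; apply/andP; split; first by lra.
  near: y; apply: lt_nbhsl; lra.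
- have ? := LP x (le_lt_trans x0 ltr01).
  by apply: is_derive_eq; rewrite subr0.
Unshelve. all: by end_near. Qed.

End antiderivatives.

Section goursat.
Context {R : realType}.

(** The supremum of the left endpoints works, since every left endpoint is at most every right
    endpoint. *)
Lemma nested_intervals (a l : nat -> R) :
  (forall n, a n <= a n.+1) -> (forall n, a n.+1 + l n.+1 <= a n + l n) ->
  (forall n, 0 <= l n) -> exists x, forall n, a n <= x <= a n + l n.
Proof.
move=> ai li l0.
have amono m k : a m <= a (m + k)%N.
  by elim: k => [|k IH]; rewrite ?addn0// addnS (le_trans IH).
have bmono m k : a (m + k)%N + l (m + k)%N <= a m + l m.
  by elim: k => [|k IH]; rewrite ?addn0// addnS; apply: le_trans IH.
have ab n m : a n <= a m + l m.
  have [/subnKC <-|/ltnW/subnKC <-] := leqP n m.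
    by apply: (le_trans (amono n (m - n)%N)); rewrite lerDl.
  by apply: le_trans (bmono m (n - m)%N); rewrite lerDl.
have hs : has_sup (range a).
  by split; [exists (a 0%N), 0%N|exists (a 0%N + l 0%N) => _ [n _ <-]].
exists (sup (range a)) => n; apply/andP; split.
  by apply: sup_upper_bound => //; exists n.
by apply: sup_le_ub => [|_ [m _ <-]//]; exists (a 0%N), 0%N.
Qed.

(* [P dx + Q dy] is differentiable at [(x, y)], with [dP/dy = dQ/dx] (both are
   [q]); no continuity of the partial derivatives is assumed. *)
Definition closed_at (P Q : R -> R -> R) (x y : R) :=
  exists p q r : R, forall e : R, 0 < e -> exists2 d : R, 0 < d &
  forall s t : R, `|s - x| < d -> `|t - y| < d ->
    `|P s t - (P x y + p * (s - x) + q * (t - y))| <= e * (`|s - x| + `|t - y|)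
    /\ `|Q s t - (Q x y + q * (s - x) + r * (t - y))|
         <= e * (`|s - x| + `|t - y|).

Variables (P Q PP QQ : R -> R -> R).
Hypothesis PPP : forall t s : R, is_derive s 1 (PP t) (P s t).
Hypothesis QQQ : forall s t : R, is_derive t 1 (QQ s) (Q s t).

(* Circulation of [P dx + Q dy] along the boundary of [[a, b] x [c, d]]: each edge
   integral is an increment of an antiderivative, so subdividing the rectangle
   is a ring identity. *)
Definition rect_circ (a b c d : R) :=
  (PP c b - PP c a) + (QQ b d - QQ b c) - (PP d b - PP d a) - (QQ a d - QQ a c).

(** The affine parts of [P] and [Q] share the cross coefficient [q], so their circulation vanishes.
    The remainder is at most [e / 2 * (l + m)] on a boundary of length [2 * (l + m)]. *)
Lemma rect_circ_local (x y : R) (e : R) : closed_at P Q x y -> 0 < e ->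
  exists2 d : R, 0 < d & forall a c l m : R, 0 <= l -> 0 <= m -> l + m < d ->
   a <= x <= a + l -> c <= y <= c + m ->
   `|rect_circ a (a + l) c (c + m)| <= e * (l + m) ^+ 2.
Proof.
move=> [p [q [r H]]] e0; have e2 : 0 < e / 2 by rewrite divr_gt0.
have {H} [d d0 H] := H _ e2; exists d => // a c l m l0 m0 lmd /andP[x1 x2] /andP[y1 y2].
have al : a <= a + l by rewrite lerDl.
have cm : c <= c + m by rewrite lerDl.
(* On a horizontal edge [t] is fixed, and the expansion of [P] is affine in [s] with slope [p]. *)
have HP (t : R) : c <= t <= c + m ->
  `|PP t (a + l) - PP t a -
    ((P x y - p * x + q * (t - y)) * (a + l - a) + p * ((a + l) ^+ 2 - a ^+ 2) / 2)|
  <= e / 2 * (l + m) * (a + l - a).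
  move=> /andP[t1 t2]; apply: (antiderivative_affine_bound al (PPP t)) => s /andP[s1 s2].
  have sx : `|s - x| <= l by rewrite ler_norml; lra.
  have ty : `|t - y| <= m by rewrite ler_norml; lra.
  have [|| + _] := H s t; [lra|lra|].
  rewrite (_ : P x y + p * (s - x) + q * (t - y) =
    P x y - p * x + q * (t - y) + p * s); last by ring.
  by move/le_trans; apply; rewrite ler_pM2l //; lra.
have HQ (s : R) : a <= s <= a + l ->
  `|QQ s (c + m) - QQ s c -
    ((Q x y - r * y + q * (s - x)) * (c + m - c) + r * ((c + m) ^+ 2 - c ^+ 2) / 2)|
  <= e / 2 * (l + m) * (c + m - c).
  move=> /andP[s1 s2]; apply: (antiderivative_affine_bound cm (QQQ s)) => t /andP[t1 t2].
  have sx : `|s - x| <= l by rewrite ler_norml; lra.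
  have ty : `|t - y| <= m by rewrite ler_norml; lra.
  have [|| _] := H s t; [lra|lra|].
  rewrite (_ : Q x y + q * (s - x) + r * (t - y) =
    Q x y - r * y + q * (s - x) + r * t); last by ring.
  by move/le_trans; apply; rewrite ler_pM2l //; lra.
have := HP c; have := HP (c + m); have := HQ a; have := HQ (a + l).
rewrite !lexx al cm /= => /(_ isT) h1 /(_ isT) h2 /(_ isT) h3 /(_ isT) h4.
rewrite /rect_circ.
move: h1 h2 h3 h4.
set A1 := QQ (a + l) _ - _; set A2 := QQ a _ - _; set A3 := PP (c + m) _ - _.
set A4 := PP c _ - _.
rewrite !ler_norml => /andP[? ?] /andP[? ?] /andP[? ?] /andP[? ?].
(* The horizontal edges contribute [- q * l * m] and the vertical ones [q * l * m]; all other main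
   terms cancel between opposite edges. *)
apply/andP; split; nra.
Qed.

(** Goursat's bisection: a nonzero circulation [E] would leave at least [|E| / 4 ^ n] on some
    rectangle of the [n]-th generation, while the local bound at the common point of these
    rectangles is smaller than that for large [n]. *)
Lemma rect_circ_eq0 (a b c d : R) : a <= b -> c <= d ->
  (forall x y, a <= x <= b -> c <= y <= d -> closed_at P Q x y) ->
  rect_circ a b c d = 0.
Proof.
move=> ab cd cl; apply/eqP; apply: contraT => E0.
set E := rect_circ a b c d in E0.
pose h n : R := 2 ^- n.
have h0 n : 0 < h n by rewrite invr_gt0 exprn_gt0.
have hS n : h n = 2 * h n.+1 by rewrite /h exprS invfM mulrA divff ?mul1r.
pose L n := (b - a) * h n; pose M n := (d - c) * h n.
have L0 n : 0 <= L n by rewrite mulr_ge0 ?subr_ge0 // ltW.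
have M0 n : 0 <= M n by rewrite mulr_ge0 ?subr_ge0 // ltW.
pose C n (z : R * R) := rect_circ z.1 (z.1 + L n) z.2 (z.2 + M n).
pose good n (z z' : R * R) := [/\ z.1 <= z'.1, z'.1 + L n.+1 <= z.1 + L n,
  z.2 <= z'.2, z'.2 + M n.+1 <= z.2 + M n & `|C n z| <= 4 * `|C n.+1 z'|].
have step n z : exists z', good n z z'.
  have LS : L n = L n.+1 + L n.+1 by rewrite /L hS; ring.
  have MS : M n = M n.+1 + M n.+1 by rewrite /M hS; ring.
  have := L0 n.+1; have := M0 n.+1.
  set l := L n.+1 in LS *; set m := M n.+1 in MS * => l0 m0.
  pose z1 := z; pose z2 := (z.1 + l, z.2); pose z3 := (z.1, z.2 + m).
  pose z4 := (z.1 + l, z.2 + m).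
  have Csum : C n z = C n.+1 z1 + C n.+1 z2 + C n.+1 z3 + C n.+1 z4.
    rewrite /C /= -/l -/m LS MS !addrA /rect_circ; ring.
  have [h1|h1] := leP `|C n z| (4 * `|C n.+1 z1|).
    by exists z1; split => //=; rewrite -/l -/m; lra.
  have [h2|h2] := leP `|C n z| (4 * `|C n.+1 z2|).
    by exists z2; split => //=; rewrite -/l -/m; lra.
  have [h3|h3] := leP `|C n z| (4 * `|C n.+1 z3|).
    by exists z3; split => //=; rewrite -/l -/m; lra.
  have [h4|h4] := leP `|C n z| (4 * `|C n.+1 z4|).
    by exists z4; split => //=; rewrite -/l -/m; lra.
  exfalso.
  have : `|C n z| <= `|C n.+1 z1| + `|C n.+1 z2| + `|C n.+1 z3| + `|C n.+1 z4|.
    by rewrite Csum; do 2 (apply: (le_trans (ler_normD _ _)); rewrite lerD2r);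
       exact: ler_normD.
  lra.
have [f fP] : exists f : nat -> R * R -> R * R, forall n z, good n z (f n z).
  have [g gP] := choice (fun nz : nat * (R * R) => step nz.1 nz.2).
  by exists (fun n z => g (n, z)) => n z; exact: (gP (n, z)).
pose z := fix z n := if n is k.+1 then f k (z k) else (a, c).
have zP n : good n (z n) (z n.+1) by exact: fP.
have [x Hx] := @nested_intervals (fun n => (z n).1) L
  (fun n => let: And5 h _ _ _ _ := zP n in h)
  (fun n => let: And5 _ h _ _ _ := zP n in h) L0.
have [y Hy] := @nested_intervals (fun n => (z n).2) M
  (fun n => let: And5 _ _ h _ _ := zP n in h)
  (fun n => let: And5 _ _ _ h _ := zP n in h) M0.
have CE n : `|E| * h n ^+ 2 <= `|C n (z n)|.
  elim: n => [|n IH].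
    rewrite /C /L /M /= /h expr0 invr1 !mulr1 expr1n mulr1.
    by rewrite !(addrC _ (_ - _)) !subrK.
  have [_ _ _ _ /(le_trans IH)] := zP n.
  rewrite hS exprMn mulrCA (_ : 2 ^+ 2 = 4); last by ring.
  by rewrite ler_pM2l.
pose S := (b - a) + (d - c).
have S0 : 0 <= S by rewrite addr_ge0 ?subr_ge0.
have clxy : closed_at P Q x y.
  have := Hx 0%N; have := Hy 0%N; rewrite /= /L /M /h expr0 invr1 !mulr1.
  by rewrite !(addrC _ (_ - _)) !subrK => ? ?; exact: cl.
(* This tolerance makes [e * S ^+ 2] smaller than [|E|]; using [S + 1] keeps the denominator
   positive when the rectangle is a point. *)
have e0 : 0 < `|E| / (2 * (S + 1) ^+ 2).
  by rewrite divr_gt0 ?normr_gt0// mulr_gt0// exprn_gt0//; lra.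
have [r r0 rP] := rect_circ_local clxy e0.
have [n nr] : exists n, S * h n < r.
  exists (Num.bound (S / r)); set n := Num.bound _.
  rewrite /h ltr_pdivrMr ?exprn_gt0// mulrC -ltr_pdivrMr//.
  have /lt_le_trans := archi_boundP (divr_ge0 S0 (ltW r0)); apply.
  by rewrite -natrX ler_nat ltnW// ltn_expl.
have := rP (z n).1 (z n).2 (L n) (M n) (L0 n) (M0 n) _ (Hx n) (Hy n).
have -> : L n + M n = S * h n by rewrite /L /M /S; ring.
move=> /(_ nr) /(le_trans (CE n)).
rewrite exprMn [leRHS]mulrA ler_pM2r ?exprn_gt0// mulrAC ler_pdivlMr; last first.
  by rewrite mulr_gt0// exprn_gt0//; lra.
rewrite ler_pM2l ?normr_gt0//; nra.
Qed.

End goursat.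

(** * Means over a period of a closed form on the plane *)

Section strip.
Context {R : realType}.

Definition continuous2 (p : R -> R -> R) := forall x y e : R, 0 < e ->
  exists2 d : R, 0 < d & forall s t : R, `|s - x| < d -> `|t - y| < d ->
  `|p s t - p x y| < e.

Lemma continuous2_fst p y : continuous2 p -> continuous (p ^~ y).
Proof.
move=> cp x; apply/cvgrPdist_lt => e e0; have [d d0 H] := cp x y e e0.
exists d => //= s /= sd; rewrite distrC; apply: H; first by rewrite distrC.
by rewrite subrr normr0.
Qed.

Lemma continuous2_snd p x : continuous2 p -> continuous (p x).
Proof.
move=> cp y; apply/cvgrPdist_lt => e e0; have [d d0 H] := cp x y e e0.
exists d => //= s /= sd; rewrite distrC; apply: H; last by rewrite distrC.
by rewrite subrr normr0.
Qed.

(** Compactness of [[a, b]] makes [d] uniform in [t]; this yields continuity of the mean over a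
    period. *)
Lemma continuous2_tube p (x a b e : R) : continuous2 p -> 0 < e ->
  exists2 d : R, 0 < d & forall s t : R, `|s - x| < d -> a <= t <= b ->
  `|p s t - p x t| < e.
Proof.
move=> cp e0; have e2 : 0 < e / 2 by rewrite divr_gt0.
have /compact_near_coveringP := @segment_compact R a b.
move=> /(_ R (nbhs x) (fun s t => `|p s t - p x t| < e) _) [].
  move=> y _; have [d d0 H] := cp x y _ e2.
  exists ([set t | `|t - y| < d], [set s | `|s - x| < d]) => /=.
    split.
      by exists d => //= t; rewrite /ball /= distrC.
    by exists d => //= t; rewrite /ball /= distrC.
  move=> [t s] /= [ty sx].
  have h1 := H s t sx ty.
  have h2 := H x t _ ty; rewrite subrr normr0 in h2; have {}h2 := h2 d0.
  rewrite (_ : p s t - p x t = (p s t - p x y) - (p x t - p x y)); last by ring.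
  by apply: (le_lt_trans (ler_normB _ _)); lra.
move=> d /= d0 H; exists d => // s t sx tab; apply: H.
  by rewrite /ball /= distrC.
by rewrite /= in_itv.
Qed.

Variables (p q : R -> R -> R) (tau al be c0 c1 : R).
Hypotheses (tau0 : 0 < tau) (cp : continuous2 p) (cq : continuous2 q).
Hypothesis qper : forall s, q s tau = q s 0.
Hypothesis pq_closed : forall s t, s != al -> s != be -> closed_at q p s t.
Hypothesis p_minfty : forall e : R, 0 < e ->
  exists M : R, forall s t : R, s < M -> `|p s t - c0| <= e.
Hypothesis p_pinfty : forall e : R, 0 < e ->
  exists M : R, forall s t : R, M < s -> `|p s t - c1| <= e.

(* [fun s => A (p s) tau - A (p s) 0], the integral of [p s] over a period, is
   constant in [s]: the horizontal edges of the circulation of [q ds + p dt]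
   cancel by periodicity. *)
Lemma strip_mean_value : c0 = c1.
Proof.
(* [A] selects one antiderivative for each continuous function; on a discontinuous [h] it takes the
   arbitrary value [h]. *)
have [A AP] : exists A : (R -> R) -> R -> R,
    forall h, continuous h -> forall x : R, is_derive x 1 (A h) (h x).
  have [A AP] := choice (fun h : R -> R =>
    match pselect (continuous h) with
    | left ch => let: ex_intro H HP := antiderivative_exists ch in
                 ex_intro (fun H => continuous h -> forall x : R, is_derive x 1 H (h x))
                   H (fun=> HP)
    | right nch => ex_intro _ h (fun ch => False_ind _ (nch ch))
    end).
  by exists A.
pose phi s := A (p s) tau - A (p s) 0.
have dp (s t : R) : is_derive t 1 (A (p s)) (p s t) by apply: AP; exact: continuous2_snd.
have dq (t s : R) : is_derive s 1 (A (q ^~ t)) (q s t).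
  by apply: (AP (q ^~ t)); exact: continuous2_fst.
have phic (s c e : R) : (forall t, `|p s t - c| <= e) -> `|phi s - c * tau| <= e * tau.
  move=> H; have := antiderivative_affine_bound (ltW tau0) (dp s).
  move=> /(_ c 0 e); rewrite /phi subr0 !mul0r addr0; apply => x _.
  by rewrite mul0r addr0.
have phis (s s' e : R) : (forall t, 0 <= t <= tau -> `|p s t - p s' t| <= e) ->
    `|phi s - phi s'| <= e * tau.
  move=> H.
  have dH (t : R) : is_derive t 1 (fun t => A (p s) t - A (p s') t) (p s t - p s' t).
    exact: is_deriveB.
  have := is_derive_eq_bound (ltW tau0) dH H; rewrite subr0.
  by apply: le_trans; rewrite le_eqVlt; apply/orP; left; apply/eqP;
     congr `|_|; rewrite /phi; ring.
have cphi : continuous phi.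
  move=> x; apply/cvgrPdist_le => e e0.
  have e1 : 0 < e / tau by rewrite divr_gt0.
  have [d d0 H] := continuous2_tube x 0 tau cp e1.
  exists d => //= s /= sx; rewrite distrC.
  have := @phis s x (e / tau); rewrite divfK ?gt_eqF//; apply => t tab.
  by apply/ltW/H => //; rewrite distrC.
have phi_const1 (s s' : R) : s <= s' -> (forall x, s <= x <= s' -> x != al /\ x != be) ->
    phi s = phi s'.
  move=> ss' H.
  have := rect_circ_eq0 dq dp ss' (ltW tau0).
  rewrite /rect_circ => /(_ (fun x y xss _ => let: conj xa xb := H x xss in pq_closed y xa xb)).
  (* Equality as functions is what matters: [A] then selects the same antiderivative on both
     horizontal edges. *)
  have -> : q ^~ tau = q ^~ 0 by apply/funext => x.
  rewrite /phi; lra.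
(* The endpoints may now be exceptional: [phi] equals its value at the midpoint throughout the open
   interval, and continuity extends this to both ends. *)
have phi_const2 (s s' : R) : s <= s' ->
    (forall x, s < x < s' -> x != al /\ x != be) -> phi s = phi s'.
  rewrite le_eqVlt => /orP[/eqP->//|ss'] H.
  pose m := (s + s') / 2.
  have sm : s < m by rewrite /m; lra.
  have ms : m < s' by rewrite /m; lra.
  have phim x : s < x < s' -> phi x = phi m.
    move=> /andP[sx xs'].
    by have [xm|/ltW mx] := leP x m; [|symmetry]; apply: phi_const1 => // y
      /andP[y1 y2]; apply: H; lra.
  have ps : phi x @[x --> s^'+] --> phi m.
    apply: cvg_near_cst; near=> x; apply: phim; apply/andP; split; near: x.
      exact: nbhs_right_gt.
    exact: nbhs_right_lt.
  have ps' : phi x @[x --> s'^'-] --> phi m.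
    apply: cvg_near_cst; near=> x; apply: phim; apply/andP; split; near: x.
      exact: nbhs_left_gt.
    exact: nbhs_left_lt.
  rewrite -(cvg_lim _ (cvg_at_right_filter (cphi s)))//.
  by rewrite -(cvg_lim _ (cvg_at_left_filter (cphi s')))// !(cvg_lim _ ps, cvg_lim _ ps').
(* Here [u] and [v] stand for [al] and [be] in increasing order, and the path from [s] to [s'] is
   cut at both. *)
have phi_const3 (u v s s' : R) : s < u -> u <= v -> v < s' ->
    (forall x, x != u -> x != v -> x != al /\ x != be) -> phi s = phi s'.
  move=> su uv vs' H.
  have H' (x y z : R) : x <= y <= u \/ u <= x /\ y <= v \/ v <= x -> x < z < y ->
      z != al /\ z != be.
    move=> h /andP[xz zy]; apply: H; apply/negP => /eqP zE; subst z.
      by move: h => [/andP[]|[[]|]]; lra.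
    by move: h => [/andP[]|[[]|]]; lra.
  rewrite (@phi_const2 s u) ?(ltW su)// => [|x]; last first.
    by apply: H'; left; rewrite lexx ltW.
  rewrite (@phi_const2 u v)// => [|x]; last by apply: H'; right; left.
  by apply: phi_const2 => [|x]; [exact: ltW|apply: H'; right; right].
have phi_const (s s' : R) : s < al -> s < be -> al < s' -> be < s' -> phi s = phi s'.
  move=> sa sb as' bs'; have [ab|/ltW ab] := leP al be.
    exact: (@phi_const3 al be).
  by apply: (@phi_const3 be al).
apply/eqP; rewrite -subr_eq0 -normr_eq0 eq_le normr_ge0 andbT.
apply/ler_addgt0Pr => e e0; rewrite add0r.
have e2 : 0 < e / 2 by rewrite divr_gt0.
have [M0 M0P] := p_minfty e2; have [M1 M1P] := p_pinfty e2.
(* [s] and [s'] lie beyond the thresholds for the two limits and on opposite sides of both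
   exceptional lines. *)
pose s := Num.min M0 (Num.min al be) - 1.
pose s' := Num.max M1 (Num.max al be) + 1.
have hs : [/\ s < M0, s < al & s < be].
  have : s < Num.min M0 (Num.min al be) by rewrite /s; lra.
  by rewrite !lt_min => /and3P[].
have hs' : [/\ M1 < s', al < s' & be < s'].
  have : Num.max M1 (Num.max al be) < s' by rewrite /s'; lra.
  by rewrite !gt_max => /and3P[].
case: hs hs' => h1 h2 h3 [h4 h5 h6].
have := phic s c0 _ (fun t => M0P s t h1); have := phic s' c1 _ (fun t => M1P s' t h4).
rewrite (phi_const s s')// => ha hb.
rewrite -(ler_pM2r tau0) -{1}(gtr0_norm tau0) -normrM.
rewrite (_ : (c0 - c1) * tau = (phi s' - c1 * tau) - (phi s' - c0 * tau)); last by ring.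
by apply: (le_trans (ler_normB _ _)); lra.
Unshelve. all: by end_near. Qed.

End strip.

(** * Complex differentiation *)

(** The quotient-free form also covers [h = 0]. Being valid over the reals and the complex numbers
    alike, it carries real expansions over to [cexp]. *)
Lemma is_derive1_littleoP (K : numFieldType) (f : K -> K) (z D : K) :
  is_derive z 1 f D <-> forall e : K, 0 < e ->
    exists2 d : K, 0 < d &
      forall h : K, `|h| < d -> `|f (z + h) - f z - D * h| <= e * `|h|.
Proof.
have E h : h != 0 -> `|D - h^-1 *: (f (h *: 1 + z) - f z)| * `|h| =
    `|f (z + h) - f z - D * h|.
  move=> h0; rewrite -normrM -normrN; congr `|_|.
  rewrite /GRing.scale /= mulr1 (addrC z h).
  by rewrite mulrBl mulrAC mulVf// mul1r opprB.
split=> [[dv vD]|H].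
  have /cvgrPdist_le H : h^-1 *: (f (h *: 1 + z) - f z) @[h --> 0^'] --> D.
    by rewrite -vD; exact: dv.
  move=> e /H [d /= d0 {}H]; exists d => // h hd.
  have [->|h0] := eqVneq h 0.
    by rewrite addr0 subrr mulr0 subr0 normr0 mulr0.
  have := H h; rewrite /= sub0r normrN => /(_ hd h0).
  by rewrite -(ler_pM2r (_ : 0 < `|h|)) ?normr_gt0// E.
have cD : h^-1 *: (f (h *: 1 + z) - f z) @[h --> 0^'] --> D.
  apply/cvgrPdist_le => /= e /H[d d0 {}H].
  exists d => //= h /=; rewrite sub0r normrN => hd h0.
  by rewrite -(ler_pM2r (_ : 0 < `|h|)) ?normr_gt0// E//; exact: H.
by apply: DeriveDef; [apply/cvg_ex; exists D|exact: cvg_lim].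
Qed.

(** * The complex exponential and its derivative *)

Section complex_exponential.
Context {R : realType}.
Local Notation C := (Cplx R).
Local Notation Re := (@complex.Re R).
Local Notation Im := (@complex.Im R).
Implicit Types (z w h : C) (x y r : R).

Lemma norm_ofrealE z : `|z| = ofreal (Num.sqrt (Re z ^+ 2 + Im z ^+ 2)).
Proof. by case: z. Qed.

Lemma ofrealM : {morph @ofreal R : x y / x * y}.
Proof. by move=> x y; rewrite /ofreal rmorphM. Qed.
Lemma ofreal_inj : injective (@ofreal R).
Proof. by move=> x y []. Qed.
Lemma ler_ofreal : {mono @ofreal R : x y / x <= y}.
Proof. by move=> x y; rewrite lecR. Qed.
Lemma ltr_ofreal : {mono @ofreal R : x y / x < y}.
Proof. by move=> x y; rewrite ltcR. Qed.
Lemma ofreal_gt0 x : (0 < ofreal x) = (0 < x).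
Proof. by rewrite -[RHS]ltr_ofreal. Qed.

(** In the partial order of the complex numbers a positive element has zero imaginary part, so
    complex tolerances are real ones. *)
Lemma gt0_ofreal (e : C) : 0 < e -> exists2 r : R, 0 < r & e = ofreal r.
Proof.
by case: e => a b; rewrite ltcE /= => /andP[/eqP -> a0]; exists a.
Qed.

Lemma ler_Re_norm z : ofreal `|Re z| <= `|z|.
Proof.
rewrite norm_ofrealE ler_ofreal -[leLHS]sqrtr_sqr ler_wsqrtr//.
by rewrite lerDl sqr_ge0.
Qed.

Lemma ler_Im_norm z : ofreal `|Im z| <= `|z|.
Proof.
rewrite norm_ofrealE ler_ofreal -[leLHS]sqrtr_sqr ler_wsqrtr//.
by rewrite lerDr sqr_ge0.
Qed.

Lemma norm_le_ReIm z : `|z| <= ofreal (`|Re z| + `|Im z|).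
Proof.
rewrite norm_ofrealE ler_ofreal.
rewrite -[leRHS]ger0_norm ?addr_ge0// -sqrtr_sqr ler_wsqrtr//.
rewrite sqrrD !real_normK ?num_real// addrAC lerDl mulrn_wge0// mulr_ge0//.
Qed.

Lemma complex_ReD z w : Re (z + w) = Re z + Re w. Proof. by case: z w => ? ? []. Qed.
Lemma complex_ImD z w : Im (z + w) = Im z + Im w. Proof. by case: z w => ? ? []. Qed.
Lemma complex_ReN z : Re (- z) = - Re z. Proof. by case: z. Qed.
Lemma complex_ImN z : Im (- z) = - Im z. Proof. by case: z. Qed.
Lemma complex_ReM z w : Re (z * w) = Re z * Re w - Im z * Im w.
Proof. by case: z w => ? ? []. Qed.
Lemma complex_ImM z w : Im (z * w) = Re z * Im w + Im z * Re w.
Proof. by case: z w => ? ? []. Qed.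

Lemma imagE : 'i = Complex 0 1 :> C.
Proof. exact: (esym (complexiE R)). Qed.

Lemma cexpE z : cexp z = Complex (expR (Re z) * cos (Im z)) (expR (Re z) * sin (Im z)) :> C.
Proof.
rewrite /cexp imagE /ofreal.
apply/eqP; rewrite eq_complex /= ; apply/andP; split; apply/eqP; simpc; ring.
Qed.

Lemma cexpD z w : cexp (z + w) = cexp z * cexp w.
Proof.
rewrite !cexpE complex_ReD complex_ImD expRD cosD sinD.
apply/eqP; rewrite eq_complex; apply/andP; split; apply/eqP; rewrite ?complex_ReM ?complex_ImM/=; ring.
Qed.

Lemma cexp0 : cexp 0 = 1 :> C.
Proof. by rewrite cexpE /= expR0 cos0 sin0 mulr1 mulr0. Qed.

Lemma norm_cexp z : `|cexp z| = ofreal (expR (Re z)).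
Proof.
rewrite norm_ofrealE cexpE /=; congr ofreal.
by rewrite !exprMn -mulrDr cos2Dsin2 mulr1 sqrtr_sqr ger0_norm// expR_ge0.
Qed.

(** The addition formula reduces the claim to [cexp h - 1 - h] near 0, which is estimated from the
    expansions of [expR], [sin] and [cos] at 0. *)
Lemma is_derive_cexp z : is_derive z 1 (@cexp R) (cexp z).
Proof.
have /is_derive1_littleoP exp0 := is_derive_expR (0 : R).
have /is_derive1_littleoP sin1 := is_derive_sin (0 : R).
have /is_derive1_littleoP cos1 := is_derive_cos (0 : R).
apply/is_derive1_littleoP => _ /gt0_ofreal[e e0 ->].
pose k := expR (Re z).
have k0 : 0 < k by exact: expR_gt0.
(* The remainder will be at most [k * (16 * r * n)] with [n] the modulus of [h], whence the 16 and
   the factor [k]. *)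
have [r [r0 r1 rle]] : exists r, [/\ 0 < r, r <= 1 & r <= e / k / 16].
  exists (Num.min (e / k / 16) 1); rewrite lt_min ltr01 andbT !divr_gt0//.
  by rewrite !ge_min !lexx orbT.
have [d1 d10 H1] := exp0 _ r0.
have [d2 d20 H2] := sin1 _ r0.
have [d3 d30 H3] := cos1 _ r0.
exists (ofreal (Num.min (Num.min d1 d2) (Num.min d3 r))).
  by rewrite ofreal_gt0 !lt_min d10 d20 d30.
move=> h; set N := `|h|; have [n nE] : exists n, N = ofreal n by eexists; exact: norm_ofrealE.
rewrite nE ltr_ofreal !lt_min => /andP[/andP[n1 n2] /andP[n3 n4]].
have xn : `|Re h| <= n by have := ler_Re_norm h; rewrite -/N nE ler_ofreal.
have yn : `|Im h| <= n by have := ler_Im_norm h; rewrite -/N nE ler_ofreal.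
have n0 : 0 <= n by apply: le_trans xn.
rewrite cexpD -{2}[cexp z]mulr1 -mulrBr -mulrBr normrM norm_cexp -/k.
have := H1 (Re h) (le_lt_trans xn n1).
have := H2 (Im h) (le_lt_trans yn n2).
have := H3 (Im h) (le_lt_trans yn n3).
rewrite !add0r expR0 sin0 cos0 !(oppr0, mul0r, subr0, addr0, mul1r).
set x := Re h; set y := Im h => hc hs he.
(* The real and imaginary parts of [u] are bounded by [4 * (n * r)] and [5 * (n * r)]; quadratic
   terms are absorbed through [n < r]. *)
set u := cexp h - 1 - h.
have hu : `|u| <= ofreal (16 * r * n).
  apply: (le_trans (norm_le_ReIm u)); rewrite ler_ofreal.
  rewrite /u !complex_ReD !complex_ImD !complex_ReN !complex_ImN cexpE /= -/x -/y subr0.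
  have xr : `|x| * r <= n * r by rewrite ler_wpM2r// ltW.
  have yr : `|y| * r <= n * r by rewrite ler_wpM2r// ltW.
  have nr : n * r <= n by rewrite ler_piMr.
  have nn : n * n <= n * r by rewrite ler_wpM2l// ltW.
  have A1 : `|expR x * cos y - 1 - x| <= 4 * (n * r).
    rewrite (_ : _ - x = (expR x - 1 - x) * cos y + (1 + x) * (cos y - 1)); last by ring.
    apply: (le_trans (ler_normD _ _)); rewrite !normrM.
    have c2 : `|cos y| <= 2.
      by rewrite (_ : cos y = (cos y - 1) + 1); [apply: (le_trans (ler_normD _ _)); rewrite normr1; lra|ring].
    have x2 : `|1 + x| <= 2.
      by apply: (le_trans (ler_normD _ _)); rewrite normr1; lra.
    have := ler_pM (normr_ge0 _) (normr_ge0 _) he c2.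
    have := ler_pM (normr_ge0 _) (normr_ge0 _) x2 hc.
    lra.
  have A2 : `|expR x * sin y - y| <= 5 * (n * r).
    rewrite (_ : _ - y = (expR x - 1) * sin y + (sin y - y)); last by ring.
    apply: (le_trans (ler_normD _ _)); rewrite !normrM.
    have c2 : `|sin y| <= 2 * n.
      by rewrite (_ : sin y = (sin y - y) + y); [apply: (le_trans (ler_normD _ _)); lra|ring].
    have x2 : `|expR x - 1| <= 2 * n.
      by rewrite (_ : expR x - 1 = (expR x - 1 - x) + x); [apply: (le_trans (ler_normD _ _)); lra|ring].
    have := ler_pM (normr_ge0 _) (normr_ge0 _) x2 c2.
    lra.
  have := mulr_ge0 n0 (ltW r0). lra.
apply: (@le_trans _ _ (ofreal (k * (16 * r * n)))).
  by rewrite ofrealM ler_pM2l// ofreal_gt0.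
rewrite -ofrealM ler_ofreal mulrA ler_wpM2r//.
by move: rle; rewrite !ler_pdivlMr//; lra.
Qed.

End complex_exponential.

Lemma derivable_comp1 (K : numFieldType) (f g : K -> K) (z : K) :
  derivable f z 1 -> derivable g (f z) 1 -> derivable (g \o f) z 1.
Proof.
move=> /derivable1_diffP df /derivable1_diffP dg.
by apply/derivable1_diffP; exact: (differentiable_comp df dg).
Qed.

Lemma derivable1_continuous (K : numFieldType) (f : K -> K) (z : K) :
  derivable f z 1 -> {for z, continuous f}.
Proof. by move=> /derivable1_diffP/differentiable_continuous. Qed.

(** * The mean value property with two exceptional circles *)

Section mean_value_circles.
Context {R : realType}.
Local Notation C := (Cplx R).
Local Notation Re := (@complex.Re R).
Local Notation Im := (@complex.Im R).
Implicit Types (z w h : C) (x y r : R).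

Lemma norm_Complex_le x y : `|Complex x y : C| <= ofreal (`|x| + `|y|).
Proof. exact: norm_le_ReIm. Qed.

Lemma ComplexD x y x' y' : (Complex x y : C) + Complex x' y' = Complex (x + x') (y + y').
Proof. by []. Qed.

Lemma continuous2_ReIm (G : C -> C) : continuous G ->
  continuous2 (fun x y => Re (G (Complex x y))) /\
  continuous2 (fun x y => Im (G (Complex x y))).
Proof.
move=> cG; have main (x y e : R) : 0 < e -> exists2 d : R, 0 < d &
    forall s t : R, `|s - x| < d -> `|t - y| < d ->
    `|G (Complex s t) - G (Complex x y)| < ofreal e.
  move=> e0; have /cvgrPdist_lt/(_ (ofreal e)) := cG (Complex x y).
  rewrite ofreal_gt0 => /(_ e0)[_ /= /gt0_ofreal[d d0 ->] H].
  exists (d / 2); first by rewrite divr_gt0.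
  move=> s t sx ty; rewrite distrC; apply: H => /=.
  apply: (le_lt_trans (@norm_Complex_le (x - s) (y - t))).
  by rewrite ltr_ofreal !(distrC x, distrC y); lra.
split=> x y e /(main x y)[d d0 H]; exists d => // s t sx ty.
  rewrite -ltr_ofreal; apply: le_lt_trans (H s t sx ty).
  by apply: le_trans (ler_Re_norm _); rewrite complex_ReD complex_ReN.
rewrite -ltr_ofreal; apply: le_lt_trans (H s t sx ty).
by apply: le_trans (ler_Im_norm _); rewrite complex_ImD complex_ImN.
Qed.

(* The Cauchy-Riemann equations say that [Im G ds + Re G dt] is closed. *)
Lemma closed_at_ImRe (G : C -> C) x y : derivable G (Complex x y) 1 ->
  closed_at (fun x y => Im (G (Complex x y))) (fun x y => Re (G (Complex x y))) x y.
Proof.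
move=> dG; have [D /is_derive1_littleoP H] : exists D : C, is_derive (Complex x y : C) 1 G D.
  by exists ('D_1 G (Complex x y : C)); exact: derivableP.
exists (Im D), (Re D), (- Im D) => e e0.
have := H (ofreal e); rewrite ofreal_gt0 => /(_ e0)[_ /gt0_ofreal[d d0 ->] {}H].
exists (d / 2); first by rewrite divr_gt0.
move=> s t sx ty; have := H (Complex (s - x) (t - y)).
have hn := norm_Complex_le (s - x) (t - y).
have hd : `|Complex (s - x) (t - y) : C| < ofreal d.
  by apply: le_lt_trans hn _; rewrite ltr_ofreal; lra.
rewrite ComplexD !(addrC _ (_ - _)) !subrK => /(_ hd) {}H.
have {}H : `|G (Complex s t) - G (Complex x y) - D * (Complex (s - x) (t - y))| <=
    ofreal (e * (`|s - x| + `|t - y|)).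
  by apply: (le_trans H); rewrite ofrealM ler_wpM2l// ltW// ofreal_gt0.
split; rewrite -ler_ofreal.
  apply: le_trans (le_trans (ler_Im_norm _) H).
  rewrite ler_ofreal !(complex_ImD, complex_ImN, complex_ImM) /= le_eqVlt; apply/orP; left; apply/eqP.
    congr `|_|. ring.
apply: le_trans (le_trans (ler_Re_norm _) H).
by rewrite ler_ofreal !(complex_ReD, complex_ReN, complex_ReM) /= le_eqVlt; apply/orP; left; apply/eqP;
  congr `|_|; ring.
Qed.

Lemma cexp_derivable z : derivable (@cexp R) z 1.
Proof. exact: (@ex_derive _ _ _ _ _ _ _ (is_derive_cexp z)). Qed.

Lemma CinftyP (F : C -> C) (c : C) : F z @[z --> Cinfty R] --> c <->
  forall e : R, 0 < e -> exists M : R, forall z : C, ofreal M < `|z| -> `|F z - c| <= ofreal e.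
Proof.
split=> [/cvgrPdist_le H e e0|H].
  have := H (ofreal e); rewrite ofreal_gt0 => /(_ e0)[M _ {}H].
  by exists M => z /H /=; rewrite distrC.
apply/cvgrPdist_le => _ /gt0_ofreal[e e0 ->].
by have [M MP] := H e e0; exists M => // z /= /MP; rewrite distrC.
Qed.

(** Under [cexp] the vertical lines [s = 0] and [s = ln rho] map to the exceptional circles, and the
    composite has period [2 pi] in [t]. Its limits at the two ends of the [s]-axis are [F 0] and
    [c]. *)
Lemma mean_value_two_circles_Re (F : C -> C) (rho : R) (c : C) : continuous F -> 0 < rho ->
  (forall z, `|z| != 1 -> `|z| != ofreal rho -> derivable F z 1) ->
  F z @[z --> Cinfty R] --> c -> Re (F 0) = Re c.
Proof.
move=> cF rho0 dF /CinftyP Fc.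
pose G := F \o @cexp R.
have cG : continuous G.
  by move=> z; apply: continuous_comp; [exact/derivable1_continuous/cexp_derivable|exact: cF].
have [cp cq] := continuous2_ReIm cG.
have tau0 : 0 < pi *+ 2 :> R by rewrite mulrn_wgt0 // pi_gt0.
apply: (strip_mean_value tau0 cp cq (al := 0) (be := ln rho)).
- by move=> s; rewrite /G /= !cexpE /= cos0 sin0 cos2pi sin2pi.
- move=> s t s0 srho; apply: closed_at_ImRe; apply: derivable_comp1.
    exact: cexp_derivable.
  apply: dF; rewrite norm_cexp /=.
    apply: contra s0 => /eqP; rewrite -[1]/(ofreal 1) => /ofreal_inj.
    by rewrite -expR0 => /expR_inj ->.
  apply: contra srho => /eqP/ofreal_inj <-.
  by rewrite expRK.
- move=> e e0.
  have := cF 0 => /cvgrPdist_lt/(_ (ofreal e)).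
  rewrite ofreal_gt0 => /(_ e0)[_ /= /gt0_ofreal[d d0 ->] H].
  exists (ln d) => s t sd; rewrite -ler_ofreal.
  apply: (@le_trans _ _ `|G (Complex s t) - F 0|).
    by apply: le_trans (ler_Re_norm _); rewrite complex_ReD complex_ReN.
  apply/ltW; rewrite distrC; apply: H; rewrite /= sub0r normrN norm_cexp ltr_ofreal /=.
  by rewrite -(lnK d0) ltr_expR.
(* [M] may be negative or zero, so the logarithm is taken of [|M| + 1]. *)
- move=> e /Fc[M H]; exists (ln (`|M| + 1)) => s t sM; rewrite -ler_ofreal.
  apply: (@le_trans _ _ `|G (Complex s t) - c|).
    by apply: le_trans (ler_Re_norm _); rewrite complex_ReD complex_ReN.
  apply: H; rewrite norm_cexp ltr_ofreal /=.
  have M1 : 0 < `|M| + 1 by rewrite ltr_wpDl.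
  apply: (@lt_trans _ _ (`|M| + 1)); first by have := ler_norm M; lra.
  by rewrite -{1}(lnK M1) ltr_expR.
Qed.

(** The imaginary part is recovered by applying the real case to ['i * F]. *)
Lemma mean_value_two_circles (F : C -> C) (rho : R) (c : C) : continuous F -> 0 < rho ->
  (forall z, `|z| != 1 -> `|z| != ofreal rho -> derivable F z 1) ->
  F z @[z --> Cinfty R] --> c -> F 0 = c.
Proof.
move=> cF rho0 dF Fc.
have hRe := mean_value_two_circles_Re cF rho0 dF Fc.
have hIm : Re ('i * F 0) = Re ('i * c).
  apply: (@mean_value_two_circles_Re (fun z => 'i * F z) rho _ _ rho0).
  - by move=> z; apply: continuousM; [exact: cst_continuous|exact: cF].
  - by move=> z z1 zr; apply: derivableM; [exact: derivable_cst|exact: dF].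
  - by apply: cvgM; [exact: cvg_cst|exact: Fc].
move: hRe hIm; rewrite imagE !complex_ReM /=; case: (F 0) (c) => a b [a' b'] /= -> h.
by congr Complex; lra.
Qed.

End mean_value_circles.

Lemma cvg_at_distP (K : numFieldType) (f : K -> K) (z l : K) :
  f x @[x --> z] --> l <-> forall e : K, 0 < e -> exists2 d : K, 0 < d &
    forall x, `|x - z| < d -> `|f x - l| <= e.
Proof.
split=> [/cvgrPdist_le H e /H[d /= d0 {}H]|H].
  by exists d => // x xz; rewrite distrC; apply: H; rewrite /= distrC.
apply/(@cvgrPdist_le _ _ _ _ (nbhs_filter z)) => e /H[d d0 {}H]; exists d => //= x /= xz.
by rewrite distrC; apply: H; rewrite distrC.
Qed.

(** * Liouville's theorem with an exceptional circle *)

Section liouville.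
Context {R : realType}.
Local Notation C := (Cplx R).
Local Notation Re := (@complex.Re R).
Local Notation Im := (@complex.Im R).
Implicit Types (z w h : C) (x y r : R).

Lemma cvg_inv_Cinfty : (fun z : C => z^-1) @ Cinfty R --> (0 : C).
Proof.
apply/CinftyP => e e0; exists e^-1 => z ez.
have z0 : 0 < `|z|.
  by apply: lt_trans ez; rewrite ofreal_gt0 invr_gt0.
rewrite subr0 normfV.
have := ez; rewrite norm_ofrealE in z0 *; move: z0; set n := Num.sqrt _.
rewrite ofreal_gt0 ltr_ofreal => n0 en.
have -> : (ofreal n)^-1 = ofreal n^-1 by rewrite /ofreal fmorphV.
by rewrite ler_ofreal -[leRHS]invrK lef_pV2 ?posrE ?invr_gt0// ltW.
Qed.

(** The difference quotient [q] at [w], completed by the derivative, is continuous, and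
    differentiable off the unit circle and the circle through [w]. The mean value property for
    [K z = z * q z], with [K 0 = 0] and limit [c - F w] at infinity, gives the claim. *)
Lemma liouville_off_circle (F : C -> C) (c w : C) : continuous F ->
  (forall z, `|z| != 1 -> derivable F z 1) -> F z @[z --> Cinfty R] --> c ->
  `|w| != 1 -> F w = c.
Proof.
(* At [w = 0] the circle through [w] would have radius 0; there the mean value property applies to
   [F] itself, with both circles equal to the unit circle. *)
move=> cF dF Fc w1; have [->|w0] := eqVneq w 0.
  by apply: (@mean_value_two_circles R F 1 c cF ltr01 _ Fc) => z z1 _; exact: dF.
have [D DP] : exists D : C, is_derive w 1 F D.
  by exists ('D_1 F w); apply: derivableP; exact: dF.
pose q (z : C) : C := if z == w then D else (F z - F w) / (z - w).
have qE z : z != w -> \forall x \near z, (F x - F w) / (x - w) = q x.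
  move=> zw; exists `|z - w|; first by rewrite /= normr_gt0 subr_eq0.
  move=> x /= xz; rewrite /q; case: eqP xz => // ->.
  by rewrite ltxx.
have cq z : q x @[x --> z] --> q z.
  have [->|zw] := eqVneq z w.
    move/is_derive1_littleoP : DP => DP.
    apply/cvg_at_distP => e e0; have [d d0 H] := DP e e0.
    exists d => // x xw; rewrite /q eqxx; case: eqP => [_|/eqP xw0].
      by rewrite subrr normr0 ltW.
    have xw1 : 0 < `|x - w| by rewrite normr_gt0 subr_eq0.
    rewrite -(ler_pM2r xw1) -normrM mulrBl divfK ?subr_eq0//.
    by have := H (x - w) xw; rewrite (addrC w) subrK.
  have -> : q z = (F z - F w) / (z - w) by rewrite /q (negPf zw).
  apply: cvg_trans (near_eq_cvg (qE z zw)) _.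
  apply: cvgM; first by apply: cvgB; [exact: cF|exact: cvg_cst].
  apply: cvgV; first by rewrite subr_eq0.
  by apply: cvgB; [exact: cvg_id|exact: cvg_cst].
have dq z : `|z| != 1 -> `|z| != `|w| -> derivable q z 1.
  move=> z1 zw; have {}zw : z != w by apply: contra zw => /eqP ->.
  apply: (near_eq_derivable (qE z zw)).
  apply: derivableM; first by apply: derivableB; [exact: dF|exact: derivable_cst].
  apply: derivableV; first by rewrite subr_eq0.
  by apply: derivableB; [exact: derivable_id|exact: derivable_cst].
pose K (z : C) : C := z * q z.
have n0 : 0 < Num.sqrt (Re w ^+ 2 + Im w ^+ 2) by rewrite -ofreal_gt0 -norm_ofrealE normr_gt0.
have Kc : K z @[z --> Cinfty R] --> c - F w.
  have inv0 := cvg_inv_Cinfty.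
  (* Away from 0 and [w], [K z] equals this product, whose limit can be read off. *)
  have : (F z - F w) * (1 - w * z^-1)^-1 @[z --> Cinfty R] --> (c - F w) * (1 - w * 0)^-1.
    apply: cvgM; first by apply: cvgB; [exact: Fc|exact: cvg_cst].
    apply: cvgV; first by rewrite mulr0 subr0 oner_neq0.
    apply: cvgB; first exact: cvg_cst.
    by apply: cvgM; [exact: cvg_cst|exact: inv0].
  rewrite mulr0 subr0 invr1 mulr1; apply: cvg_trans; apply: near_eq_cvg.
  exists (Num.sqrt (Re w ^+ 2 + Im w ^+ 2)) => // z /=; rewrite -norm_ofrealE => wz.
  have z0 : z != 0 by rewrite -normr_gt0; apply: le_lt_trans wz.
  have zw : z != w by apply: contraTneq wz => ->; rewrite ltxx.
  rewrite /K /q (negPf zw) mulrCA; congr (_ * _).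
  have zw0 : z - w != 0 by rewrite subr_eq0.
  have -> : 1 - w * z^-1 = (z - w) / z by rewrite mulrBl divff.
  by rewrite invf_div.
have K0 : K 0 = c - F w.
  apply: (@mean_value_two_circles R K _ _ _ n0 _ Kc).
    by move=> z; apply: (@continuousM _ _ id q); [exact: cvg_id|exact: cq].
  move=> z z1; rewrite -norm_ofrealE => zw.
  by apply: derivableM; [exact: derivable_id|exact: dq].
apply/eqP; rewrite eq_sym -subr_eq0 -K0 /K mul0r; exact: eqxx.
Qed.

(** The order on the complex numbers is partial, but moduli are real and hence comparable. *)
Lemma norm_trichotomy z : [\/ 1 < `|z|, `|z| < 1 | `|z| = 1].
Proof.
rewrite norm_ofrealE -[1]/(ofreal 1) !ltr_ofreal.
by case: ltgtP => [||<-]; [constructor 1|constructor 2|constructor 3].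
Qed.

Lemma near_norm_gt1 z : 1 < `|z| -> \forall x \near z, 1 < `|x|.
Proof.
rewrite -subr_gt0 => zr; exists (`|z| - 1) => // x /= xz.
have := ler_normD (z - x) x; rewrite subrK => /le_lt_trans h.
have := h (`|z| - 1 + `|x|); rewrite ltrD2r => /(_ xz).
by rewrite -addrA -ltrBlDl subrr addrC subr_gt0.
Qed.

Lemma near_norm_lt1 z : `|z| < 1 -> \forall x \near z, `|x| < 1.
Proof.
rewrite -subr_gt0 => zr; exists (1 - `|z|) => // x /= xz.
rewrite -[x](subrK z) (le_lt_trans (ler_normD _ _))//.
by rewrite -ltrBrDr distrC.
Qed.

(** At a point of the circle, the limits from outside, from inside and along the circle are all
    [B z]. Together they control a full neighbourhood, so the glued function is continuous and
    Liouville's theorem applies. *)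
Lemma glued_across_circle (Fo Fi B : C -> C) (c : C) :
  (forall z, 1 < `|z| -> derivable Fo z 1) ->
  (forall z, `|z| < 1 -> derivable Fi z 1) ->
  (forall z, `|z| = 1 -> B @ within [set x | `|x| = 1] (nbhs z) --> B z) ->
  (forall z, `|z| = 1 -> Fo @ within [set x | 1 < `|x|] (nbhs z) --> B z) ->
  (forall z, `|z| = 1 -> Fi @ within [set x | `|x| < 1] (nbhs z) --> B z) ->
  Fo @ Cinfty R --> c ->
  (forall z, 1 < `|z| -> Fo z = c) /\ (forall z, `|z| < 1 -> Fi z = c).
Proof.
move=> dFo dFi cB cFo cFi Foc.
pose F (z : C) : C := if 1 < `|z| then Fo z else if `|z| < 1 then Fi z else B z.
have Fgt z : 1 < `|z| -> F z = Fo z by rewrite /F => ->.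
have Flt z : `|z| < 1 -> F z = Fi z.
  by rewrite /F => z1; rewrite (lt_gtF z1) z1.
have Feq z : `|z| = 1 -> F z = B z by rewrite /F => ->; rewrite ltxx.
have dF z : `|z| != 1 -> derivable F z 1.
  move=> zn1; have [z1|z1|z1] := norm_trichotomy z.
  - apply: near_eq_derivable (dFo z z1).
    by apply: filterS (near_norm_gt1 z1) => x /Fgt.
  - apply: near_eq_derivable (dFi z z1).
    by apply: filterS (near_norm_lt1 z1) => x /Flt.
  - by exfalso; move: zn1; rewrite z1 eqxx.
have cF : continuous F.
  move=> z; have [z1|z1] := eqVneq `|z| 1; last first.
    exact/derivable1_continuous/dF.
  rewrite /continuous_at (Feq z z1) => A nA.
  have h1 : \forall x \near z, 1 < `|x| -> A (Fo x) := cFo z z1 A nA.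
  have h2 : \forall x \near z, `|x| < 1 -> A (Fi x) := cFi z z1 A nA.
  have h3 : \forall x \near z, `|x| = 1 -> A (B x) := cB z z1 A nA.
  suff : \forall x \near z, A (F x) by [].
  apply: (filterS3 (nbhs_filter z) _ h1 h2 h3) => x x1 x2 x3.
  case: (norm_trichotomy x) => xx.
  - by rewrite Fgt//; exact: x1.
  - by rewrite Flt//; exact: x2.
  - by rewrite Feq//; exact: x3.
have Fc : F @ Cinfty R --> c.
  apply: cvg_trans Foc; apply: near_eq_cvg.
  by exists 1 => // z /= z1; rewrite Fgt.
have H z := @liouville_off_circle F c z cF dF Fc.
split=> z z1; first by rewrite -Fgt// H// gt_eqF.
by rewrite -Flt// H// lt_eqF.
Qed.

End liouville.

(** * The Riemann-Hilbert problem *)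

Lemma cvg_mxP (K : numFieldType) (T : Type) (F : set_system T) (FF : Filter F)
    (m n : nat) (f : T -> 'M[K]_(m, n)) (M : 'M[K]_(m, n)) :
  f @ F --> M <-> forall i j, f x i j @[x --> F] --> M i j.
Proof.
split=> [fM i j|fM].
  exact: (cvg_comp _ (fun N : 'M[K]_(m, n) => N i j) fM (@coord_continuous K m n i j M)).
apply/cvg_ballP => e e0.
have H : \forall x \near F, forall ij : 'I_m * 'I_n, ball (M ij.1 ij.2) e (f x ij.1 ij.2).
  apply: filter_forall => -[i j] /=.
  by move/cvg_ballP : (fM i j); exact.
by apply: filterS H => x Hx; split => // i j; exact: (Hx (i, j)).
Qed.

Lemma cvg_within_eq (K : numFieldType) (U : topologicalType) (f g : K -> U)
    (D : set K) (z : K) (l : U) : (forall w, D w -> g w = f w) ->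
  f w @[w --> z] --> l -> g @ within D (nbhs z) --> l.
Proof.
move=> gf fl A nA; have := fl A nA.
by apply: (@filterS _ _ (nbhs_filter z)) => w /= Aw Dw; rewrite gf.
Qed.

Lemma mulmx2E (K : pzSemiRingType) (A B : 'M[K]_2) i j :
  (A *m B) i j = A i 0 * B 0 j + A i 1 * B 1 j.
Proof.
rewrite mxE !big_ord_recl big_ord0 addr0.
by congr (A i _ * B _ j + A i _ * B _ j); apply/val_inj.
Qed.

Lemma derivable_mulmx2 (K : numFieldType) (A B : K -> 'M[K]_2) (z : K) :
  (forall i j, derivable (fun x => A x i j) z 1) ->
  (forall i j, derivable (fun x => B x i j) z 1) ->
  forall i j, derivable (fun x => (A x *m B x) i j) z 1.
Proof.
move=> dA dB i j; under eq_fun do rewrite mulmx2E.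
by apply: derivableD; (apply: derivableM; [exact: dA|exact: dB]).
Qed.

Lemma cvg_mulmx2 (K : numFieldType) (T : Type) (F : set_system T)
    (FF : Filter F) (A B : T -> 'M[K]_2) (a b : 'M[K]_2) :
  A @ F --> a -> B @ F --> b ->
  forall i j, (A x *m B x) i j @[x --> F] --> (a *m b) i j.
Proof.
move=> /cvg_mxP Aa /cvg_mxP Bb i j.
rewrite mulmx2E; under eq_fun do rewrite mulmx2E.
by apply: cvgD; (apply: cvgM; [exact: Aa|exact: Bb]).
Qed.

Lemma mulmx_mx2 (K : pzSemiRingType) (a b c d a' b' c' d' : K) :
  mx2 a b c d *m mx2 a' b' c' d' =
  mx2 (a * a' + b * c') (a * b' + b * d') (c * a' + d * c') (c * b' + d * d').
Proof.
apply/matrixP => i j; rewrite mulmx2E !mxE.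
by case: i => -[|[|//]] ?; case: j => -[|[|//]] ?.
Qed.

Lemma mx2_id (K : pzSemiRingType) : mx2 1 0 0 1 = 1%:M :> 'M[K]_2.
Proof.
apply/matrixP => i j; rewrite !mxE.
by case: i => -[|[|//]] ?; case: j => -[|[|//]] ?.
Qed.

Section riemann_hilbert.
Context {R : realType}.
Local Notation C := (Cplx R).
Implicit Types (z w h : C) (x y r : R).

(** [E'] and [N'] are the inverses of [E] and [N]. The exterior factor may be singular at 0, since
    it is used only outside and on the circle. *)
Lemma explicit_RHP_solution (X T : R) (G : 'M[C]_2) (E E' N N' : C -> 'M[C]_2) :
  (forall z, z != 0 -> forall i j, derivable (fun z => E z i j) z 1) ->
  (forall z, z != 0 -> forall i j, derivable (fun z => E' z i j) z 1) ->
  (forall z i j, derivable (fun z => N z i j) z 1) ->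
  (forall z i j, derivable (fun z => N' z i j) z 1) ->
  (forall z, E z *m E' z = 1%:M) -> (forall z, N z *m N' z = 1%:M) ->
  (forall i j, E z i j @[z --> Cinfty R] --> (1%:M : 'M[C]_2) i j) ->
  (forall i j, E' z i j @[z --> Cinfty R] --> (1%:M : 'M[C]_2) i j) ->
  (forall z, `|z| = 1 -> jump_matrix X T G z = N' z *m E z) ->
  unique_RHP_solution X T G (fun z => if 1 < `|z| then E z else N z).
Proof.
move=> dE dE' dN dN' EE' NN' E1 E'1 J.
have nz1 z : `|z| = 1 -> z != 0 by rewrite -normr_eq0 => ->; rewrite oner_eq0.
have ngt z : 1 < `|z| -> z != 0.
  by move=> z1; rewrite -normr_gt0; apply: lt_trans z1.
have cE z : z != 0 -> E w @[w --> z] --> E z.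
  by move=> z0; apply/(cvg_mxP (nbhs_filter z)) => i j; exact: (derivable1_continuous (dE z z0 i j)).
have cN z : N w @[w --> z] --> N z.
  by apply/(cvg_mxP (nbhs_filter z)) => i j; exact: (derivable1_continuous (dN z i j)).
have cE' z : z != 0 -> E' w @[w --> z] --> E' z.
  by move=> z0; apply/(cvg_mxP (nbhs_filter z)) => i j; exact: (derivable1_continuous (dE' z z0 i j)).
have cN' z : N' w @[w --> z] --> N' z.
  by apply/(cvg_mxP (nbhs_filter z)) => i j; exact: (derivable1_continuous (dN' z i j)).
split.
  split; [|split].
  - move=> z zn1 i j; have [z1|z1|z1] := norm_trichotomy z.
    + apply: near_eq_derivable (dE z (ngt z z1) i j).
      by apply: filterS (near_norm_gt1 z1) => x ->.
    + apply: near_eq_derivable (dN z i j).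
      by apply: filterS (near_norm_lt1 z1) => x /lt_gtF ->.
    + by exfalso; move: zn1; rewrite z1 eqxx.
  (* Both factors are continuous across the circle and so serve as their own boundary values. *)
  - exists E, N; split.
    + by apply/subspace_continuousP => z /nz1 /cE; exact: cvg_within_eq.
    + by apply/subspace_continuousP => z _; exact: cvg_within_eq.
    + by move=> z /nz1 /cE; apply: cvg_within_eq => w /= ->.
    + by move=> z _; apply: cvg_within_eq (cN z) => w /= /lt_gtF ->.
    + by move=> z z1; rewrite J// mulmxA NN' mul1mx.
  - apply/cvg_mxP => i j; apply: cvg_trans (E1 i j); apply: near_eq_cvg.
    by exists 1 => // z /= ->.
move=> Q [dQ [[Qe [Qi [cQe cQi Qe_lim Qi_lim QJ]]] Q1]] z zn1.
move/subspace_continuousP : cQi => cQi.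
have key i j : (forall z, 1 < `|z| -> (Q z *m E' z) i j = (1%:M : 'M[C]_2) i j) /\
    (forall z, `|z| < 1 -> (Q z *m N' z) i j = (1%:M : 'M[C]_2) i j).
  apply: (@glued_across_circle _ _ _ (fun z => (Qi z *m N' z) i j)).
  - move=> w w1; apply: derivable_mulmx2 => k l; last exact: dE' (ngt w w1) k l.
    by apply: dQ; rewrite gt_eqF.
  - move=> w w1; apply: derivable_mulmx2 => k l; last exact: dN'.
    by apply: dQ; rewrite lt_eqF.
  - move=> w w1; apply: cvg_mulmx2; last exact: cvg_within_eq (cN' w).
    exact: (cQi w w1).
  - move=> w w1.
    (* By the jump condition [Qe E' = Qi N' E E' = Qi N'] on the circle, so the two pieces match. *)
    have -> : (Qi w *m N' w) i j = (Qe w *m E' w) i j.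
      by rewrite QJ// J// -!mulmxA EE' mulmx1.
    apply: cvg_mulmx2; last exact: cvg_within_eq (cE' w (nz1 w w1)).
    exact: Qe_lim.
  - move=> w w1; apply: cvg_mulmx2; last exact: cvg_within_eq (cN' w).
    exact: Qi_lim.
  - rewrite -[1%:M]mulmx1; apply: cvg_mulmx2; first exact: Q1.
    by apply/cvg_mxP => k l; exact: E'1.
have [z1|z1|z1] := norm_trichotomy z; last by exfalso; move: zn1; rewrite z1 eqxx.
  (* A one-sided inverse of a square matrix is two-sided, so [Q = Q E' E = E]. *)
  rewrite z1 -[LHS]mulmx1 -(mulmx1C (EE' z)) mulmxA.
  suff -> : Q z *m E' z = 1%:M by rewrite mul1mx.
  by apply/matrixP => i j; exact: (key i j).1.
rewrite (lt_gtF z1) -[LHS]mulmx1 -(mulmx1C (NN' z)) mulmxA.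
suff -> : Q z *m N' z = 1%:M by rewrite mul1mx.
by apply/matrixP => i j; exact: (key i j).2.
Qed.

End riemann_hilbert.

Lemma derivable_mx2 (K : numFieldType) (a b c d : K -> K) (z : K) :
  derivable a z 1 -> derivable b z 1 -> derivable c z 1 -> derivable d z 1 ->
  forall i j, derivable (fun x => mx2 (a x) (b x) (c x) (d x) i j) z 1.
Proof.
move=> da db dc dd i j; under eq_fun do rewrite mxE.
by case: ifP => _; case: ifP => _; [exact: da|exact: db|exact: dc|exact: dd].
Qed.

(** * Diagonal and antidiagonal jumps *)

Section diagonal_jumps.
Context {R : realType}.
Local Notation C := (Cplx R).
Implicit Types (z w h : C) (x y r : R).

Lemma cexpK z : cexp z * cexp (- z) = 1.
Proof. by rewrite -cexpD subrr cexp0. Qed.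

Lemma derivable_cexp_comp (f : C -> C) z :
  derivable f z 1 -> derivable (fun w => cexp (f w)) z 1.
Proof. by move=> df; apply: (derivable_comp1 df); exact: cexp_derivable. Qed.

Lemma derivable_mulC (k : C) (f : C -> C) z :
  derivable f z 1 -> derivable (fun w => k * f w) z 1.
Proof. by move=> df; apply: derivableM; [exact: derivable_cst|exact: df]. Qed.

Lemma cvg_cexp_inv_Cinfty (k : C) :
  cexp (k * z^-1) @[z --> Cinfty R] --> (1 : C).
Proof.
rewrite -cexp0 -[X in cexp X](mulr0 k).
apply: (cvg_comp (fun z => k * z^-1) (@cexp R)).
  by apply: cvgM; [exact: cvg_cst|exact: cvg_inv_Cinfty].
exact: derivable1_continuous (@cexp_derivable R (k * 0)).
Qed.

(** Only values outside the circle enter the limit at infinity, and there the function is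
    identically 0. *)
Lemma is_Psi0 (X T : R) (G : 'M[C]_2) (E N : C -> 'M[C]_2) :
  (forall z, E z 0 1 = 0) ->
  unique_RHP_solution X T G (fun z => if 1 < `|z| then E z else N z) ->
  is_Psi X T G 0.
Proof.
move=> E0 U; eexists; first exact: U.
apply: (cvg_trans (near_eq_cvg _) (cvg_cst 0)).
by exists 1 => // z /= ->; rewrite E0 !mulr0.
Qed.

Lemma jump_matrixE (X T : R) (a b c d z : C) (f := 'i * phase X T z) :
  jump_matrix X T (mx2 a b c d) z =
  mx2 a (b * cexp (- (f + f))) (c * cexp (f + f)) d.
Proof.
rewrite /jump_matrix /exp_sigma3 -/f !mulmx_mx2 opprK opprD !cexpD.
rewrite !(mul0r, mulr0, addr0, add0r).
have e1 := cexpK f; have e2 := cexpK (- f); rewrite opprK in e2.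
congr mx2.
- by rewrite mulrAC e2 mul1r.
- by rewrite mulrAC mulrC.
- by rewrite mulrAC mulrC.
- by rewrite mulrAC e1 mul1r.
Qed.

Lemma is_Psi_diagonal (X T : R) (u v : C) : u * v = 1 ->
  is_Psi X T (mx2 u 0 0 v) 0.
Proof.
move=> uv; apply: (@is_Psi0 _ _ _ (fun=> mx2 1 0 0 1) (fun=> mx2 v 0 0 u)).
  by move=> z; rewrite mxE.
have cst (M : 'M[C]_2) z i j : derivable (fun=> M i j) z 1 by exact: derivable_cst.
apply: (@explicit_RHP_solution _ _ _ _ _ (fun=> mx2 1 0 0 1) _ (fun=> mx2 u 0 0 v)).
- by move=> z _ i j; exact: cst.
- by move=> z _ i j; exact: cst.
- by move=> z i j; exact: cst.
- by move=> z i j; exact: cst.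
- by move=> z; rewrite mx2_id mulmx1.
- by move=> z; rewrite mulmx_mx2 !(mul0r, mulr0, addr0, add0r) mulrC uv mx2_id.
- by move=> i j; rewrite -mx2_id; exact: cvg_cst.
- by move=> i j; rewrite -mx2_id; exact: cvg_cst.
- by move=> z _; rewrite jump_matrixE !mul0r mx2_id mulmx1.
Qed.

Lemma is_Psi_antidiagonal (X T : R) (u v : C) : u * v = -1 ->
  is_Psi X T (mx2 0 u v 0) 0.
Proof.
move=> uv.
(* The antidiagonal entries carry twice the exponent ['i * phase]: its singular part is [4 * 'i / z]
   and its entire part is [th], which here includes the factor [2 * 'i]. *)
pose k : C := 4 * 'i.
pose th (z : C) := (2 * 'i) * (z * ofreal X + z ^+ 2 * ofreal T).
pose E (z : C) := mx2 (cexp (k * z^-1)) 0 0 (cexp (- k * z^-1)).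
pose E' (z : C) := mx2 (cexp (- k * z^-1)) 0 0 (cexp (- - k * z^-1)).
(* The minus signs make [N] the inverse of [N'], because [u * v = -1]. *)
pose N (z : C) := mx2 0 (- u * cexp (-1 * th z)) (- v * cexp (th z)) 0.
pose N' (z : C) := mx2 0 (u * cexp (-1 * th z)) (v * cexp (th z)) 0.
have cE (l : C) z : z != 0 -> derivable (fun z => cexp (l * z^-1)) z 1.
  move=> z0; apply: derivable_cexp_comp; apply: derivable_mulC.
  by apply: derivableV; [exact: z0|exact: derivable_id].
have dth z : derivable th z 1.
  apply: derivable_mulC; apply: derivableD; apply: derivableM.
  - exact: derivable_id.
  - exact: derivable_cst.
  - by under eq_fun do rewrite expr2; apply: derivableM; exact: derivable_id.
  - exact: derivable_cst.
have mx2_cvg (l : C) i j :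
    mx2 (cexp (l * z^-1)) 0 0 (cexp (- l * z^-1)) i j @[z --> Cinfty R] -->
    (mx2 1 0 0 1 : 'M[C]_2) i j.
  rewrite [in X in _ --> X]mxE; under eq_fun do rewrite mxE.
  by case: ifP => _; case: ifP => _; [exact: cvg_cexp_inv_Cinfty|exact: cvg_cst|
    exact: cvg_cst|exact: cvg_cexp_inv_Cinfty].
have c0 z : derivable (fun=> 0 : C) z 1 by exact: derivable_cst.
apply: (@is_Psi0 _ _ _ E N); first by move=> z; rewrite mxE.
apply: (@explicit_RHP_solution _ _ _ _ E E' N N').
- by move=> z z0; apply: derivable_mx2; [exact: cE|exact: c0|exact: c0|exact: cE].
- by move=> z z0; apply: derivable_mx2; [exact: cE|exact: c0|exact: c0|exact: cE].
- move=> z; apply: derivable_mx2; [exact: c0| | |exact: c0];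
    apply: derivable_mulC; apply: derivable_cexp_comp.
    by apply: derivable_mulC; exact: dth.
  exact: dth.
- move=> z; apply: derivable_mx2; [exact: c0| | |exact: c0];
    apply: derivable_mulC; apply: derivable_cexp_comp.
    by apply: derivable_mulC; exact: dth.
  exact: dth.
- move=> z; rewrite mulmx_mx2 !(mul0r, mulr0, addr0, add0r) !mulNr opprK cexpK.
  by rewrite (mulrC (cexp (- _))) cexpK mx2_id.
- move=> z; rewrite mulmx_mx2 !(mul0r, mulr0, addr0, add0r) mulN1r.
  have e1 := cexpK (th z); have e2 := cexpK (- th z); rewrite opprK in e2.
  rewrite mulrACA e2 mulrACA e1 !mulr1 !mulNr (mulrC v) uv opprK.
  exact: mx2_id.
- move=> i j; rewrite -mx2_id.
  exact: mx2_cvg.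
- move=> i j; rewrite -mx2_id; exact: mx2_cvg.
- move=> z z1; rewrite jump_matrixE mulmx_mx2 !(mul0r, mulr0, addr0, add0r).
  have z0 : z != 0 by rewrite -normr_eq0 z1 oner_eq0.
  (* This splitting of the doubled exponent factors the jump as [N' E]. *)
  have f2 : 'i * phase X T z + 'i * phase X T z = th z + k * z^-1.
    by rewrite /phase /th /k; field.
  by rewrite f2 opprD !cexpD mulN1r mulNr !mulrA.
Qed.

End diagonal_jumps.

Unset Implicit Arguments.

Theorem proposition1p8 (R : realType) (a b : Cplx R)
    (hab : (a, b) != (0, 0)) (h : a = 0 \/ b = 0) :
  forall X T : R, is_Psi X T (Gmx a b) 0.
Proof.
move=> X T.
have scale_mx2 (k p q r s : Cplx R) : k *: mx2 p q r s = mx2 (k * p) (k * q) (k * r) (k * s).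
  by apply/matrixP => i j; rewrite !mxE; case: ifP => _; case: ifP => _.
have unit_norm (c : Cplx R) : c != 0 -> (`|c|^-1 * c) * (`|c|^-1 * c^*) = 1.
  move=> c0; have n0 : `|c| != 0 by rewrite normr_eq0.
  by rewrite mulrACA -normCK expr2 mulrACA mulVf// mulr1.
case: h => h0; subst.
  have b0 : b != 0 by apply: contra hab => /eqP ->.
  rewrite /Gmx normr0 expr0n add0r sqrCK ?normr_ge0// scale_mx2 !mulr0 conjC0 mulr0.
  (* The off-diagonal entries are the conjugate of [b] and [- b], both divided by the modulus of
     [b], so their product is -1. *)
  by apply: is_Psi_antidiagonal; rewrite mulrN mulrN mulrC unit_norm.
have a0 : a != 0 by apply: contra hab => /eqP ->.
rewrite /Gmx normr0 expr0n addr0 sqrCK ?normr_ge0// scale_mx2 conjC0 oppr0 !mulr0.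
by apply: is_Psi_diagonal; exact: unit_norm.
Qed.
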